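(* Let $T^*:=\frac1\mu\ln M$. Assume $T_{2n+1}\le\tau$, $T_{2n}\ge\tau$ and $T_{2n}>T^*$ for all $n\in\mathbb N$, and set $c_n:=M^2e^{-2\mu T_{2n}}\in(0,1)$. If $$\sum_{n=0}^\infty \ln\left[e^{B_{2n+1}T_{2n+1}}\left(c_n+1-e^{-B_{2n+1}T_{2n+1}}\right)\right]=-\infty,$$ then every solution $U$ of $U_t(t)=\mathcal A U(t)+\mathcal B(t)U(t-\tau)$, $t>0$, $U(0)=U_0$ (with $U_0\in\mathcal H$ arbitrary), satisfies $\|U(t)\|\to0$ as $t\to+\infty$.
   Context: $\mathcal H$ is a Hilbert space with norm $\|\cdot\|$, and $\mathcal L(\mathcal H)$ is the space of bounded linear operators from $\mathcal H$ to itself. $\mathcal A$ is a dissipative (in general unbounded) linear operator in $\mathcal H$ generating a $C_0$-semigroup $(S(t))_{t\ge 0}$, and $M,\mu>0$ are constants with $\|S(t)\|_{\mathcal L(\mathcal H)}\le Me^{-\mu t}$ for all $t\ge 0$. The delay $\tau>0$ is a fixed constant. $\mathbb N=\{0,1,2,\dots\}$. There is a strictly increasing sequence of real numbers $(t_n)_{n\in\mathbb N}$ with $t_0=0$; put $I_n=[t_n,t_{n+1})$ and $T_n=t_{n+1}-t_n$. For each $n\in\mathbb N$, $\mathcal B(t)=0$ for $t\in I_{2n}$ and $\mathcal B(t)=\mathcal B_{2n+1}$ for $t\in I_{2n+1}$, where $\mathcal B_{2n+1}\in\mathcal L(\mathcal H)$ is a fixed operator; $B_{2n+1}:=\|\mathcal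 B_{2n+1}\|_{\mathcal L(\mathcal H)}$. A solution means a mild solution: a function $U\in C([0,\infty);\mathcal H)$ satisfying $U(t)=S(t)U_0+\int_0^t S(t-s)\mathcal B(s)U(s-\tau)\,ds$ for all $t\ge0$. The integrand is taken to be $0$ wherever $\mathcal B(s)=0$; in particular this is so for $s<t_1$, where $t_1\ge\tau$, so no values of $U$ at negative times are needed. *)

(* Defs.v *)
From Stdlib Require Import Reals Lra.
From Coquelicot Require Import Coquelicot.

Open Scope R_scope.

(** A Hilbert space is real or complex; both cases are treated at once. *)
Inductive scalar_kind : Set := RealScalars | ComplexScalars.

Definition scalars (F : scalar_kind) : AbsRing :=
  match F with RealScalars => R_AbsRing | ComplexScalars => C_AbsRing end.

Definition of_real (F : scalar_kind) : R -> scalars F :=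
  match F return R -> scalars F with
  | RealScalars => fun r => r
  | ComplexScalars => RtoC
  end.

Definition re_part (F : scalar_kind) : scalars F -> R :=
  match F return scalars F -> R with
  | RealScalars => fun z => z
  | ComplexScalars => fun z => Re z
  end.

Definition conjugate (F : scalar_kind) : scalars F -> scalars F :=
  match F return scalars F -> scalars F with
  | RealScalars => fun z => z
  | ComplexScalars => Cconj
  end.

(** Positive definiteness of [inner] follows from [inner_norm] and
    [norm_eq_zero]. *)
Record Hilbert (F : scalar_kind) : Type := {
  hilbert_space :> CompleteNormedModule (scalars F);
  inner : hilbert_space -> hilbert_space -> scalars F;
  inner_plus_l : forall x y z : hilbert_space,
    inner (plus x y) z = plus (inner x z) (inner y z);
  inner_scal_l : forall (k : scalars F) (x y : hilbert_space),
    inner (scal k x) y = mult k (inner x y);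
  inner_conj : forall x y : hilbert_space,
    inner y x = conjugate F (inner x y);
  inner_norm : forall x : hilbert_space,
    inner x x = of_real F (norm x ^ 2)
}.
Arguments hilbert_space {F} _.
Arguments inner {F _} _ _.
Arguments inner_plus_l {F} _ _ _ _.
Arguments inner_scal_l {F} _ _ _ _.
Arguments inner_conj {F} _ _ _.
Arguments inner_norm {F} _ _.

(** Restriction of scalars to the reals. Coquelicot's Riemann integral takes
    values in a normed module over [R_AbsRing]; the restricted space has the
    same carrier, group law, uniform structure and norm as the original. *)
Section RestrictScalars.

Variables (F : scalar_kind) (H : CompleteNormedModule (scalars F)).

Lemma of_real_plus (x y : R) :
  of_real F (x + y) = plus (of_real F x) (of_real F y).
Proof. destruct F; [reflexivity | apply RtoC_plus]. Qed.

Lemma of_real_mult (x y : R) :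
  of_real F (x * y) = mult (of_real F x) (of_real F y).
Proof. destruct F; [reflexivity | apply RtoC_mult]. Qed.

Lemma of_real_one : of_real F 1 = one.
Proof. destruct F; reflexivity. Qed.

Lemma abs_of_real (x : R) : abs (of_real F x) = Rabs x.
Proof. destruct F; [reflexivity | apply Cmod_R]. Qed.

Definition real_scal (r : R) (x : H) : H := scal (of_real F r) x.

Lemma real_scal_assoc (x y : R_Ring) (u : H) :
  real_scal x (real_scal y u) = real_scal (mult x y) u.
Proof.
unfold real_scal; rewrite scal_assoc.
now rewrite <- of_real_mult.
Qed.

Lemma real_scal_one (u : H) : real_scal (@one R_Ring) u = u.
Proof.
unfold real_scal; change (@one R_Ring) with 1.
rewrite of_real_one; apply scal_one.
Qed.

Lemma real_scal_distr_l (x : R_Ring) (u v : H) :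
  real_scal x (plus u v) = plus (real_scal x u) (real_scal x v).
Proof. exact (scal_distr_l (of_real F x) u v). Qed.

Lemma real_scal_distr_r (x y : R_Ring) (u : H) :
  real_scal (plus x y) u = plus (real_scal x u) (real_scal y u).
Proof.
unfold real_scal; change (plus x y) with (x + y).
rewrite of_real_plus.
exact (scal_distr_r (of_real F x) (of_real F y) u).
Qed.

Lemma real_norm_scal (l : R_AbsRing) (x : H) :
  norm (real_scal l x) <= abs l * norm x.
Proof.
unfold real_scal.
apply Rle_trans with (1 := norm_scal (of_real F l) x).
rewrite abs_of_real; apply Rle_refl.
Qed.

Definition real_module_class : ModuleSpace.class_of R_Ring H :=
  ModuleSpace.Class R_Ring H (AbelianGroup.class H)
    (ModuleSpace.Mixin R_Ring H real_scal real_scal_assoc real_scal_one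
       real_scal_distr_l real_scal_distr_r).

Definition real_normed_aux_class : NormedModuleAux.class_of R_AbsRing H :=
  NormedModuleAux.Class R_AbsRing H real_module_class (UniformSpace.class H).

Definition real_normed_class : NormedModule.class_of R_AbsRing H :=
  NormedModule.Class R_AbsRing H real_normed_aux_class
    (NormedModule.Mixin R_AbsRing
       (NormedModuleAux.Pack R_AbsRing H real_normed_aux_class H)
       norm (@norm_factor _ H) norm_triangle real_norm_scal
       norm_compat1 norm_compat2 norm_eq_zero).

Definition restrict_scalars : CompleteNormedModule R_AbsRing :=
  CompleteNormedModule.Pack R_AbsRing H
    (CompleteNormedModule.Class R_AbsRing H real_normed_class
       (CompleteSpace.class H)) H.

End RestrictScalars.

Section Operators.

Context {F : scalar_kind} {H : Hilbert F}.

(** Meaningful for bounded linear operators, i.e. when [is_linear T], so that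
    the supremum is finite. *)
Definition operator_norm (T : H -> H) : R :=
  real (Lub_Rbar (fun c => exists x : H, norm x <= 1 /\ c = norm (T x))).

(** A linear operator in [H] with domain [dom]; the values of [op] outside
    [dom] are irrelevant. *)
Record unbounded_operator : Type := {
  dom : H -> Prop;
  op : H -> H;
  dom_zero : dom zero;
  dom_plus : forall x y, dom x -> dom y -> dom (plus x y);
  dom_scal : forall (k : scalars F) x, dom x -> dom (scal k x);
  op_plus : forall x y, dom x -> dom y -> op (plus x y) = plus (op x) (op y);
  op_scal : forall (k : scalars F) x, dom x -> op (scal k x) = scal k (op x)
}.

Definition dissipative (A : unbounded_operator) : Prop :=
  forall x : H, dom A x -> re_part F (inner (op A x) x) <= 0.

(** Only the restriction of [T] to nonnegative times matters. *)
Record C0_semigroup (T : R -> H -> H) : Prop := {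
  semigroup_linear : forall t, 0 <= t -> is_linear (T t);
  semigroup_zero : forall x, T 0 x = x;
  semigroup_plus : forall s t x, 0 <= s -> 0 <= t ->
    T (s + t) x = T s (T t x);
  semigroup_cont : forall x : H,
    filterlim (fun t => T t x) (at_right 0) (locally x)
}.

(** The graph of [A] is that of the right derivative of [T] at time 0. *)
Definition generates (A : unbounded_operator) (T : R -> H -> H) : Prop :=
  C0_semigroup T /\
  forall x y : H,
    (dom A x /\ op A x = y) <->
    filterlim (fun h : R => scal (of_real F (/ h)) (minus (T h x) x))
      (at_right 0) (locally y).

Definition intermittent_feedback (t : nat -> R) (Bseq : nat -> H -> H)
    (B : R -> H -> H) : Prop :=
  forall n : nat,
    (forall s, t (2 * n)%nat <= s < t (2 * n + 1)%nat ->
       forall x, B s x = zero) /\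
    (forall s, t (2 * n + 1)%nat <= s < t (2 * n + 2)%nat ->
       forall x, B s x = Bseq (2 * n + 1)%nat x).

(** The Riemann integral agrees with the Bochner integral: when the switching
    times tend to infinity with [tau <= t 1], the integrand is bounded with
    finitely many discontinuities on each [[0, t]]. Where [B s] is the zero
    operator the integrand vanishes, whatever [U (s - tau)] is. *)
Definition mild_solution (T : R -> H -> H) (B : R -> H -> H) (tau : R)
    (U0 : H) (U : R -> H) : Prop :=
  continuous_on (fun t => 0 <= t) U /\
  forall t, 0 <= t ->
    exists I : H,
      @is_RInt (restrict_scalars F H)
        (fun s => T (t - s) (B s (U (s - tau)))) 0 t I /\
      U t = plus (T t U0) I.

End Operators.

Arguments unbounded_operator {F} H.

Definition interval_length (t : nat -> R) (n : nat) : R := t (S n) - t n.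

(* Main.v *)
Require Import Defs.
From Stdlib Require Import ssreflect Reals Lra Lia.
From Coquelicot Require Import Coquelicot.
Open Scope R_scope.

(** The solution is followed from the start [t (2n)] of one delay-free interval
    to the start [t (2n+2)] of the next.

    Since the generator is dissipative, the semigroup is a contraction
    ([generated_semigroup_contraction]). On the delay-free interval the
    solution is [T (s - t (2n)) (U (t (2n)))]; its norm therefore stays below
    [norm (U (t (2n)))], and at the end of the interval it has been reduced by
    the factor [a = M exp (- mu T_2n)], whose square is [c n]. The next
    interval has length [d <= tau] and follows an interval of length at least
    [tau], so the delayed times [s - tau] all fall in the delay-free interval
    just left. The feedback is thus a known forcing of norm at most
    [b * norm (U (t (2n)))], and Duhamel's formula with a contractive semigroup
    bounds the growth of the norm by its integral. With [x = b d] this gives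
    [norm (U s) <= (a + x) * norm (U (t (2n)))] up to [t (2n+2)]
    ([delay_cycle]).

    The logarithms summed in the hypothesis come from the factor
    [q = exp x * (a ^ 2 + 1 - exp (- x))], which is what an energy estimate
    gives for the square of the norm. The Duhamel factor is no worse:
    [(a + x) ^ 2 <= q] for [x >= 0] ([sqr_plus_le_exp]), and no derivative of
    the squared norm has to be taken. Hence the squared norm at [t (2n+2)] is at
    most the product of the [q k], [k <= n], times its initial value
    ([product_bound]). The product is the exponential of the partial sum of
    the logarithms, and tends to 0. Since [q n] also bounds the growth inside
    the cycle, the norm is small between the switching times as well, even if
    the individual [q n] are unbounded.

    The contraction property is obtained in Banach space. There, dissipativity
    reads [norm x <= norm (x - lambda A x)] for [lambda > 0]. Applied to
    [T (s + h) x] with [lambda = h], it compares [norm (T (s + h) x)] with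
    [norm (T s x)] up to an error [eps * h] that is uniform in [s], because an
    implicit Euler step follows the orbit to first order and the semigroup is
    bounded ([orbit_uniform_growth]). Adding up many small steps gives the
    contraction on the domain. The domain is dense because it contains the
    time averages of all orbits ([orbit_integral_domain],
    [orbit_average_limit]). *)

(** * Normed modules and linear maps *)

Lemma filterlim_at_right_norm {K : AbsRing} {V : NormedModule K}
    (f : R -> V) (a : R) (y : V) :
  filterlim f (at_right a) (locally y) <->
  forall eps, 0 < eps -> exists delta, 0 < delta /\
    forall h, a < h < a + delta -> norm (minus (f h) y) < eps.
Proof.
rewrite filterlim_locally_ball_norm; split.
- intros Hf eps Heps.
  destruct (Hf (mkposreal eps Heps)) as [d Hd].
  exists d; split; [apply cond_pos |].
  intros h Hh; apply (Hd h); [| lra].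
  apply Rabs_lt_between'; simpl; lra.
- intros Hf eps.
  destruct (Hf eps (cond_pos eps)) as [d [Hd Hf']].
  exists (mkposreal d Hd); intros h Hh Hah.
  apply Hf'; apply Rabs_lt_between' in Hh; simpl in Hh; lra.
Qed.

Lemma norm_minus_sym {K : AbsRing} {V : NormedModule K} (x y : V) :
  norm (minus x y) = norm (minus y x).
Proof. rewrite -(opp_minus y x); apply norm_opp. Qed.

Lemma norm_minus_triangle {K : AbsRing} {V : NormedModule K} (x y z : V) :
  norm (minus x z) <= norm (minus x y) + norm (minus y z).
Proof. rewrite (minus_trans y x z); apply norm_triangle. Qed.

Lemma plus_minus_cancel {G : AbelianGroup} (x y : G) : plus x (minus y x) = y.
Proof.
unfold minus; rewrite (plus_comm y) plus_assoc plus_opp_r.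
apply plus_zero_l.
Qed.

Lemma minus_plus_cancel {G : AbelianGroup} (x y : G) : plus (minus x y) y = x.
Proof. rewrite plus_comm; apply plus_minus_cancel. Qed.

Lemma norm_minus_diag {K : AbsRing} {V : NormedModule K} (x : V) :
  norm (minus x x) = 0.
Proof. rewrite minus_eq_zero; apply @norm_zero. Qed.

Lemma norm_scal_le {V : NormedModule R_AbsRing} (k : R) (x : V) :
  norm (scal k x) <= Rabs k * norm x.
Proof. exact (norm_scal k x). Qed.

Lemma is_linear_minus {K : AbsRing} {U V : NormedModule K} (l : U -> V)
    (x y : U) :
  is_linear l -> l (minus x y) = minus (l x) (l y).
Proof.
intros Hl.
apply (plus_reg_r (l y)).
transitivity (l x); [| symmetry; apply minus_plus_cancel].
transitivity (l (plus (minus x y) y)).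
- symmetry; apply (linear_plus l Hl).
- f_equal; apply minus_plus_cancel.
Qed.

Lemma is_linear_zero {K : AbsRing} {U V : NormedModule K} (l : U -> V) :
  is_linear l -> l zero = zero.
Proof.
intros Hl.
transitivity (l (minus zero zero)).
- f_equal; symmetry; exact (@minus_eq_zero U zero).
- exact (eq_trans (is_linear_minus l zero zero Hl)
    (@minus_eq_zero V (l zero))).
Qed.

Lemma linear_Riemann_sum {U V : NormedModule R_AbsRing} (l : U -> V)
    (f : R -> U) (ptd : SF_seq) :
  is_linear l -> l (Riemann_sum f ptd) = Riemann_sum (fun s => l (f s)) ptd.
Proof.
intros Hl; induction ptd as [x | x ptd IH] using SF_cons_ind.
- exact (is_linear_zero l Hl).
- rewrite !Riemann_sum_cons -IH.
  rewrite (linear_plus l Hl); f_equal.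
  exact (linear_scal l Hl _ _).
Qed.

(** A bounded linear map commutes with Riemann sums, and its continuity carries
    this to the limit. *)
Lemma is_RInt_linear {U V : NormedModule R_AbsRing} (l : U -> V)
    (f : R -> U) (a b : R) (I : U) :
  is_linear l -> is_RInt f a b I -> is_RInt (fun s => l (f s)) a b (l I).
Proof.
intros Hl HI.
refine (filterlim_ext _ _ _ (filterlim_comp _ _ _ _ l _ _ _ HI
  (linear_cont l I Hl))).
intros ptd; rewrite -(linear_Riemann_sum l f ptd Hl).
exact (linear_scal l Hl _ _).
Qed.

(** * Dissipative bounded semigroups are contractions *)

Section BoundedSemigroup.

Context {E : CompleteNormedModule R_AbsRing}.
Variables (T : R -> E -> E) (K : R).
Hypotheses
  (K_pos : 0 < K)
  (T_linear : forall s, 0 <= s -> is_linear (T s))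
  (T_zero : forall x, T 0 x = x)
  (T_plus : forall s r x, 0 <= s -> 0 <= r -> T (s + r) x = T s (T r x))
  (T_cont : forall x, filterlim (fun s => T s x) (at_right 0) (locally x))
  (T_bounded : forall s x, 0 <= s -> norm (T s x) <= K * norm x).

(** The graph of the generator: [y] is the generator applied to [x]. *)
Definition right_derivative_at_zero (x y : E) : Prop :=
  filterlim (fun h => scal (/ h) (minus (T h x) x)) (at_right 0) (locally y).

Lemma orbit_near_zero (x : E) (eps : R) :
  0 < eps -> exists delta, 0 < delta /\
    forall h, 0 <= h < delta -> norm (minus (T h x) x) < eps.
Proof.
intros Heps.
destruct (proj1 (filterlim_at_right_norm _ _ _) (T_cont x) eps Heps)
  as [d [Hd Hnear]].
exists d; split; [exact Hd |]; intros h Hh.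
destruct (Req_dec h 0) as [-> | Hh0].
- now rewrite T_zero norm_minus_diag.
- apply Hnear; lra.
Qed.

(** Factoring out the semigroup at the earlier of the two times reduces the
    two-sided modulus of continuity at any time to the right one at time 0. *)
Lemma orbit_increment (x : E) (s r : R) :
  0 <= s -> 0 <= r ->
  norm (minus (T r x) (T s x)) <= K * norm (minus (T (Rabs (r - s)) x) x).
Proof.
assert (Hle : forall s r, 0 <= s <= r ->
    norm (minus (T r x) (T s x)) <= K * norm (minus (T (r - s) x) x)).
{ intros u v Huv.
  replace (T v x) with (T u (T (v - u) x))
    by (rewrite -T_plus; try lra; f_equal; ring).
  rewrite -(is_linear_minus _ _ _ (T_linear u (proj1 Huv))).
  apply T_bounded; lra. }
intros Hs Hr; destruct (Rle_dec s r) as [Hsr | Hsr].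
- rewrite Rabs_pos_eq; try lra; apply Hle; lra.
- rewrite norm_minus_sym Rabs_minus_sym Rabs_pos_eq; try lra.
  apply Hle; lra.
Qed.

(** Extending the orbit evenly to negative times makes it continuous on the
    whole line, so that the integrability criterion applies up to time 0. *)
Definition orbit (x : E) (s : R) : E := T (Rabs s) x.

Lemma orbit_nonneg (x : E) (s : R) : 0 <= s -> orbit x s = T s x.
Proof. now intros Hs; unfold orbit; rewrite Rabs_pos_eq. Qed.

Lemma orbit_continuous (x : E) (s : R) : continuous (orbit x) s.
Proof.
refine (proj2 (filterlim_locally_ball_norm _ _) _); intros eps.
destruct (orbit_near_zero x (eps / K)) as [d [Hd Hnear]].
{ apply Rdiv_lt_0_compat; [apply cond_pos | exact K_pos]. }
exists (mkposreal d Hd); intros r Hr; unfold ball_norm, orbit.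
apply Rle_lt_trans with
  (1 := orbit_increment x _ _ (Rabs_pos s) (Rabs_pos r)).
replace (pos eps) with (K * (eps / K)) by (field; lra).
apply Rmult_lt_compat_l; [exact K_pos |]; apply Hnear.
split; [apply Rabs_pos |].
apply Rle_lt_trans with (1 := Rabs_triang_inv2 r s); exact Hr.
Qed.

Lemma orbit_integrable (x : E) (a b : R) : ex_RInt (orbit x) a b.
Proof.
apply (@ex_RInt_continuous E); intros; apply orbit_continuous.
Qed.

Definition orbit_integral (x : E) (h : R) : E := RInt (orbit x) 0 h.

(** The integral over [[h, h + r]] is the image under [T h] of the integral over
    [[0, r]]. *)
Lemma orbit_integral_plus (x : E) (h r : R) :
  0 <= h -> 0 <= r ->
  orbit_integral x (h + r)
  = plus (orbit_integral x h) (T h (orbit_integral x r)).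
Proof.
intros Hh Hr; unfold orbit_integral.
rewrite -(RInt_Chasles (orbit x) 0 h (h + r)); try apply orbit_integrable.
f_equal.
assert (Hshift : is_RInt (fun s => T h (orbit x s)) 0 r
    (RInt (orbit x) h (h + r))).
{ apply is_RInt_ext with (fun s => scal 1 (orbit x (1 * s + h))).
  - intros s Hs; rewrite -> Rmin_left, Rmax_right in Hs by lra.
    change (scal 1 (orbit x (1 * s + h))) with
      (scal (@one R_Ring) (orbit x (1 * s + h))).
    rewrite scal_one !orbit_nonneg; try lra.
    rewrite -T_plus; try lra.
    f_equal; ring.
  - apply (is_RInt_comp_lin (orbit x) 1 h 0 r).
    replace (1 * 0 + h) with h by ring; replace (1 * r + h) with (h + r) by ring.
    apply RInt_correct, orbit_integrable. }
rewrite -(is_RInt_unique _ _ _ _ Hshift).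
apply is_RInt_unique, is_RInt_linear.
- now apply T_linear.
- apply RInt_correct, orbit_integrable.
Qed.

Lemma orbit_average_limit (x : E) :
  filterlim (fun h => scal (/ h) (orbit_integral x h)) (at_right 0)
    (locally x).
Proof.
refine (proj2 (filterlim_at_right_norm _ _ _) _); intros eps Heps.
destruct (orbit_near_zero x (eps / 2)) as [d [Hd Hnear]]; [lra |].
exists d; split; [exact Hd |]; intros h Hh.
assert (Hint : is_RInt (fun s => minus (orbit x s) x) 0 h
    (minus (orbit_integral x h) (scal (h - 0) x))).
{ apply @is_RInt_minus; [| apply @is_RInt_const].
  apply RInt_correct, orbit_integrable. }
assert (Hmean : minus (scal (/ h) (orbit_integral x h)) x
  = scal (/ h) (minus (orbit_integral x h) (scal (h - 0) x))).
{ rewrite scal_minus_distr_l scal_assoc.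
     replace (mult (/ h) (h - 0)) with (@one R_Ring)
       by (unfold mult, one; simpl; field; lra).
     now rewrite scal_one. }
rewrite Hmean.
apply Rle_lt_trans with (1 := @norm_scal_le E _ _).
rewrite -> Rabs_pos_eq by (apply Rlt_le, Rinv_0_lt_compat; lra).
apply Rle_lt_trans with (eps / 2); [| lra].
apply Rmult_le_reg_l with h; [lra |].
rewrite <- Rmult_assoc, Rinv_r, Rmult_1_l by lra.
apply Rle_trans with ((h - 0) * (eps / 2)); [| apply Req_le; ring].
refine (norm_RInt_le_const _ 0 h _ _ ltac:(lra) _ Hint).
intros s Hs; rewrite -> orbit_nonneg by lra.
apply Rlt_le, Hnear; lra.
Qed.

(** Splitting the integral over [[0, h + r]] at [h] and at [r] shows that
    [T r - 1] applied to the integral up to [h] equals [T h - 1] applied to the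
    integral up to [r]. Divided by [r], the latter tends to [T h x - x] because
    averages over short times tend to [x]. Hence orbit integrals lie in the
    domain of the generator. *)
Lemma orbit_integral_domain (x : E) (h : R) :
  0 <= h -> right_derivative_at_zero (orbit_integral x h) (minus (T h x) x).
Proof.
intros Hh.
apply filterlim_ext_loc with
  (fun r => minus (T h (scal (/ r) (orbit_integral x r)))
              (scal (/ r) (orbit_integral x r))).
- exists (mkposreal 1 Rlt_0_1); intros r _ Hr.
  rewrite (linear_scal _ (T_linear h Hh)).
  rewrite -scal_minus_distr_l; f_equal.
  (* The terms subtracted on the two sides are distinct; adding both of them
     leaves the two splittings of the integral up to [h + r]. *)
  apply (plus_reg_l (plus (orbit_integral x h) (orbit_integral x r))).
  transitivity (plus (orbit_integral x h) (T h (orbit_integral x r))).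
  + rewrite -plus_assoc; f_equal; apply plus_minus_cancel.
  + rewrite (plus_comm (orbit_integral x h) (orbit_integral x r)).
    rewrite -plus_assoc plus_minus_cancel.
    rewrite -!orbit_integral_plus; try lra; f_equal; ring.
- apply (filterlim_comp _ _ _ _ (fun v => minus (T h v) v) _ (locally x));
    [apply orbit_average_limit |].
  apply (continuous_minus (T h) (fun v => v) x).
  + exact (linear_cont (T h) x (T_linear h Hh)).
  + apply continuous_id.
Qed.

Lemma right_derivative_orbit (x y : E) (s : R) :
  0 <= s -> right_derivative_at_zero x y ->
  right_derivative_at_zero (T s x) (T s y).
Proof.
intros Hs Hxy.
apply filterlim_ext_loc with
  (fun h => T s (scal (/ h) (minus (T h x) x))).
- exists (mkposreal 1 Rlt_0_1); intros h _ Hh.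
  rewrite (linear_scal _ (T_linear s Hs)); f_equal.
  rewrite (is_linear_minus _ _ _ (T_linear s Hs)).
  f_equal; rewrite -!T_plus; try lra; f_equal; ring.
- apply (filterlim_comp _ _ _ _ (T s) _ _ _ Hxy).
  exact (linear_cont (T s) y (T_linear s Hs)).
Qed.

(** Dissipativity of the generator in its Banach space form, which needs no
    inner product. *)
Hypothesis dissipative_derivative : forall x y,
  right_derivative_at_zero x y ->
  forall lambda, 0 < lambda -> norm x <= norm (minus x (scal lambda y)).

(** By dissipativity the norm of [T (s + h) x] is at most that of
    [T (s + h) x - h T (s + h) y], which is [T s] applied to
    [x + h (q - T h y)] with [q] the difference quotient of the orbit at time 0.
    Both [q] and [T h y] are close to [y] for small [h], whatever [s] is. *)
Lemma orbit_uniform_growth (x y : E) (eps : R) :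
  right_derivative_at_zero x y -> 0 < eps ->
  exists delta, 0 < delta /\ forall s h, 0 <= s -> 0 < h < delta ->
    norm (T (s + h) x) <= norm (T s x) + eps * h.
Proof.
intros Hxy Heps.
(* The bound [K] of [T s] multiplies two errors: [q - y] and [y - T h y]. *)
assert (Heps' : 0 < eps / (2 * K)) by (apply Rdiv_lt_0_compat; lra).
destruct (proj1 (filterlim_at_right_norm _ _ _) Hxy _ Heps')
  as [d1 [Hd1 Hder]].
destruct (orbit_near_zero y _ Heps') as [d2 [Hd2 Hcont]].
exists (Rmin d1 d2); split; [now apply Rmin_pos |].
intros s h Hs Hh.
assert (Hh1 := Rmin_l d1 d2); assert (Hh2 := Rmin_r d1 d2).
set (q := scal (/ h) (minus (T h x) x)).
assert (Hq : minus (T h x) x = scal h q).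
{ unfold q; rewrite scal_assoc.
  replace (mult h (/ h)) with (@one R_Ring)
    by (unfold mult, one; simpl; field; lra).
  now rewrite scal_one. }
assert (Hdiss := dissipative_derivative _ _
  (right_derivative_orbit x y (s + h) ltac:(lra) Hxy) h ltac:(lra)).
assert (Hsplit : minus (T (s + h) x) (scal h (T (s + h) y))
    = plus (T s x) (T s (scal h (minus q (T h y))))).
{ rewrite -(linear_plus _ (T_linear s Hs)) scal_minus_distr_l -Hq.
  rewrite !T_plus; try lra.
  rewrite -(linear_scal _ (T_linear s Hs)).
  rewrite -(is_linear_minus _ _ _ (T_linear s Hs)).
  f_equal; unfold minus; now rewrite !plus_assoc (plus_comm x)
    -(plus_assoc (T h x)) plus_opp_r plus_zero_r. }
rewrite Hsplit in Hdiss.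
apply Rle_trans with (1 := Hdiss), Rle_trans with (1 := @norm_triangle _ E _ _).
apply Rplus_le_compat_l, Rle_trans with (1 := T_bounded s _ Hs).
assert (Hnq : norm (scal h (minus q (T h y))) <= h * (eps / K)).
{ apply Rle_trans with (1 := @norm_scal_le E _ _).
  rewrite Rabs_pos_eq; try lra; apply Rmult_le_compat_l; [lra |].
  apply Rle_trans with (1 := norm_minus_triangle q y (T h y)).
  rewrite (norm_minus_sym y).
  assert (H1 := Hder h ltac:(lra)); assert (H2 := Hcont h ltac:(lra)).
  replace (eps / K) with (eps / (2 * K) + eps / (2 * K)) by (field; lra).
  apply Rplus_le_compat; [exact (Rlt_le _ _ H1) | exact (Rlt_le _ _ H2)]. }
replace (eps * h) with (K * (h * (eps / K))) by (field; lra).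
now apply Rmult_le_compat_l; [lra |].
Qed.

(** The growth estimate is uniform along the orbit, so [n] steps of length
    [s / n] lose at most [eps] altogether. *)
Lemma orbit_nonincreasing_on_domain (x y : E) (s : R) :
  right_derivative_at_zero x y -> 0 <= s -> norm (T s x) <= norm x.
Proof.
intros Hxy Hs; destruct (Rle_lt_or_eq_dec 0 s Hs) as [Hspos | <-];
  [| rewrite T_zero; lra].
apply le_epsilon; intros eps Heps.
destruct (orbit_uniform_growth x y (eps / s) Hxy) as [d [Hd Hstep]].
{ now apply Rdiv_lt_0_compat. }
destruct (archimed_cor1 (d / s)) as [n [Hn Hnpos]];
  [now apply Rdiv_lt_0_compat |].
apply lt_INR in Hnpos; simpl in Hnpos.
set (h := s / INR n).
assert (Hh : 0 < h) by now apply Rdiv_lt_0_compat.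
assert (Hhd : h < d).
{ unfold h, Rdiv; apply Rmult_lt_reg_l with (/ s);
    [now apply Rinv_0_lt_compat |].
  rewrite <- Rmult_assoc, Rinv_l, Rmult_1_l by lra.
  unfold Rdiv in Hn; lra. }
assert (Hiter : forall k : nat,
    norm (T (INR k * h) x) <= norm x + eps / s * (INR k * h)).
{ induction k as [| k IH].
  - simpl; rewrite Rmult_0_l T_zero; lra.
  - rewrite S_INR Rmult_plus_distr_r Rmult_1_l.
    assert (Hk := Hstep (INR k * h) h
      ltac:(apply Rmult_le_pos; [apply pos_INR | lra]) ltac:(lra)).
    lra. }
specialize (Hiter n).
replace (INR n * h) with s in Hiter by (unfold h; field; lra).
replace (eps / s * s) with eps in Hiter by (field; lra).
exact Hiter.
Qed.

(** The contraction extends from the averages of the orbit, which lie in the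
    domain, to their limit. *)
Lemma dissipative_semigroup_contraction (x : E) (s : R) :
  0 <= s -> norm (T s x) <= norm x.
Proof.
intros Hs.
assert (Hdense := orbit_average_limit x).
apply (filterlim_le (F := at_right 0)
  (fun h => norm (T s (scal (/ h) (orbit_integral x h))))
  (fun h => norm (scal (/ h) (orbit_integral x h)))
  (Finite (norm (T s x))) (Finite (norm x))).
- exists (mkposreal 1 Rlt_0_1); intros h _ Hh.
  apply (orbit_nonincreasing_on_domain _
    (scal (/ h) (minus (T h x) x))); [| exact Hs].
  apply filterlim_ext_loc with
    (fun r => scal (/ h) (scal (/ r)
       (minus (T r (orbit_integral x h)) (orbit_integral x h)))).
  + exists (mkposreal 1 Rlt_0_1); intros r _ Hr.
    rewrite (linear_scal _ (T_linear r (Rlt_le _ _ Hr))).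
    rewrite -scal_minus_distr_l !scal_assoc; f_equal; apply Rmult_comm.
  + apply (filterlim_comp _ _ _ _ (fun v => scal (/ h) v) _ _ _
      (orbit_integral_domain x h (Rlt_le _ _ Hh))).
    exact (@filterlim_scal_r R_AbsRing E (/ h) (minus (T h x) x)).
- apply (filterlim_comp _ _ _ _ (@norm _ E) _ (locally (T s x)));
    [| exact (@filterlim_norm _ E (T s x))].
  apply (filterlim_comp _ _ _ _ (T s) _ _ _ Hdense).
  exact (linear_cont (T s) x (T_linear s Hs)).
- apply (filterlim_comp _ _ _ _ (@norm _ E) _ _ _ Hdense).
  exact (@filterlim_norm _ E x).
Qed.

End BoundedSemigroup.
Lemma sqr_le_inv (a b : R) : 0 <= b -> a ^ 2 <= b ^ 2 -> a <= b.
Proof. intros Hb Hab; destruct (Rle_lt_dec a b); [assumption | nra]. Qed.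

(** * Mild solutions with delayed forcing *)

Section VariationOfConstants.

Context {E : CompleteNormedModule R_AbsRing}.
Variables (T : R -> E -> E) (g U : R -> E) (U0 : E).
Hypotheses
  (T_linear : forall s, 0 <= s -> is_linear (T s))
  (T_plus : forall s r x, 0 <= s -> 0 <= r -> T (s + r) x = T s (T r x))
  (T_contraction : forall s x, 0 <= s -> norm (T s x) <= norm x)
  (U_mild : forall t, 0 <= t -> exists I : E,
     is_RInt (fun s => T (t - s) (g s)) 0 t I /\ U t = plus (T t U0) I).

(** A mild solution may be restarted at any time: [T (t - a)] passes through
    the integral that enters [U a] and completes each [T (a - s)] to
    [T (t - s)]. *)
Lemma mild_restart (a t : R) :
  0 <= a <= t -> exists J : E,
    is_RInt (fun s => T (t - s) (g s)) a t J /\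
    U t = plus (T (t - a) (U a)) J.
Proof.
intros Hat.
destruct (U_mild a) as [Ia [HIa HUa]]; [lra |].
destruct (U_mild t) as [It [HIt HUt]]; [lra |].
assert (Hta : 0 <= t - a) by lra.
assert (HI : is_RInt (fun s => T (t - s) (g s)) 0 a (T (t - a) Ia)).
{ apply is_RInt_ext with (fun s => T (t - a) (T (a - s) (g s))).
  - intros s Hs; rewrite -> Rmin_left, Rmax_right in Hs by lra.
    rewrite -T_plus; try lra.
    f_equal; ring.
  - exact (is_RInt_linear _ _ _ _ _ (T_linear _ Hta) HIa). }
exists (plus (opp (T (t - a) Ia)) It); split.
- exact (@is_RInt_Chasles E _ a 0 t _ _ (is_RInt_swap _ _ _ _ HI) HIt).
- rewrite HUt HUa (linear_plus _ (T_linear _ Hta)) -T_plus; try lra.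
  replace (t - a + a) with t by ring.
  rewrite -plus_assoc (plus_assoc _ _ It) plus_opp_r plus_zero_l.
  reflexivity.
Qed.

Lemma mild_unforced (a t : R) :
  0 <= a <= t -> (forall s, a < s < t -> g s = zero) ->
  U t = T (t - a) (U a).
Proof.
intros Hat Hg; destruct (mild_restart a t Hat) as [J [HJ ->]].
replace J with (@zero E); [apply plus_zero_r |].
assert (Hzero : is_RInt (fun _ => @zero E) a t J).
{ apply is_RInt_ext with (2 := HJ).
  intros s Hs; rewrite -> Rmin_left, Rmax_right in Hs by lra.
  rewrite -> Hg by lra.
  exact (is_linear_zero _ (T_linear (t - s) ltac:(lra))). }
assert (Hnorm := norm_RInt_le_const _ _ _ _ 0 (proj2 Hat)
  (fun s _ => Req_le _ _ (@norm_zero _ E)) Hzero).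
symmetry; apply (@norm_eq_zero _ E), Rle_antisym; [| apply norm_ge_0].
rewrite -> Rmult_0_r in Hnorm; exact Hnorm.
Qed.

Lemma mild_forced_growth (a t C : R) :
  0 <= a <= t -> (forall s, a <= s <= t -> norm (g s) <= C) ->
  norm (U t) <= norm (U a) + (t - a) * C.
Proof.
intros Hat Hg; destruct (mild_restart a t Hat) as [J [HJ ->]].
apply Rle_trans with (1 := @norm_triangle _ E _ _), Rplus_le_compat.
- apply T_contraction; lra.
- refine (norm_RInt_le_const _ a t _ _ (proj2 Hat) _ HJ).
  intros s Hs; apply Rle_trans with (2 := Hg s Hs).
  apply T_contraction; lra.
Qed.

(** One cycle, with feedback off on [[p, r)] and on during [[r, q]]. The two
    length conditions place [s - tau] in [[p, r]] for every [s] in [[r, q]], so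
    the delayed values are bounded by [norm (U p)]. *)
Lemma delay_cycle (M mu tau beta p r q : R) :
  (forall s x, 0 <= s -> norm (T s x) <= M * exp (- mu * s) * norm x) ->
  0 <= p -> p + tau <= r -> 0 <= tau -> r < q <= r + tau -> 0 <= beta ->
  (forall s, p <= s < r -> g s = zero) ->
  (forall s, r <= s <= q -> norm (g s) <= beta * norm (U (s - tau))) ->
  (forall s, p <= s <= r -> norm (U s) <= norm (U p)) /\
  (forall s, r <= s <= q ->
     norm (U s) <= (M * exp (- mu * (r - p)) + beta * (q - r)) * norm (U p)).
Proof.
intros Hdecay Hp Hpr Htau Hrq Hbeta Hoff Hon.
assert (Hrest : forall s, p <= s <= r -> U s = T (s - p) (U p)).
{ intros s Hs; apply mild_unforced; [lra |].
  intros v Hv; apply Hoff; lra. }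
assert (Hsmall : forall s, p <= s <= r -> norm (U s) <= norm (U p)).
{ intros s Hs; rewrite -> Hrest by exact Hs; apply T_contraction; lra. }
split; [exact Hsmall |]; intros s Hs.
assert (Hgrowth : norm (U s) <= norm (U r) + (s - r) * (beta * norm (U p))).
{ apply mild_forced_growth; [lra |]; intros v Hv.
  apply Rle_trans with (1 := Hon v ltac:(lra)), Rmult_le_compat_l;
    [exact Hbeta | apply Hsmall; lra]. }
assert (Hr : norm (U r) <= M * exp (- mu * (r - p)) * norm (U p)).
{ rewrite -> Hrest by lra; apply Hdecay; lra. }
assert (Hlen : (s - r) * (beta * norm (U p)) <= (q - r) * (beta * norm (U p))).
{ apply Rmult_le_compat_r; [| lra].
  apply Rmult_le_pos; [exact Hbeta | apply norm_ge_0]. }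
lra.
Qed.

End VariationOfConstants.

(** * Operators in Hilbert space *)

Section HilbertSpace.

Context {F : scalar_kind} {H : Hilbert F}.

Lemma re_part_of_real (x : R) : re_part F (of_real F x) = x.
Proof. destruct F; reflexivity. Qed.

Lemma re_part_plus (x y : scalars F) :
  re_part F (plus x y) = re_part F x + re_part F y.
Proof. destruct F; reflexivity. Qed.

Lemma re_part_mult_of_real (k : R) (x : scalars F) :
  re_part F (mult (of_real F k) x) = k * re_part F x.
Proof.
destruct F; [reflexivity |]; destruct x as [x1 x2]; simpl; ring.
Qed.

Lemma re_part_conjugate (x : scalars F) :
  re_part F (conjugate F x) = re_part F x.
Proof. destruct F; reflexivity. Qed.

Lemma re_inner_diag (x : H) : re_part F (inner x x) = norm x ^ 2.
Proof. rewrite inner_norm; apply re_part_of_real. Qed.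

Lemma re_inner_plus_r (x y z : H) :
  re_part F (inner x (plus y z))
  = re_part F (inner x y) + re_part F (inner x z).
Proof.
rewrite !(inner_conj H _ x) !re_part_conjugate inner_plus_l.
apply re_part_plus.
Qed.

Lemma norm_plus_sqr (x y : H) :
  norm (plus x y) ^ 2 = norm x ^ 2 + 2 * re_part F (inner x y) + norm y ^ 2.
Proof.
rewrite -!re_inner_diag inner_plus_l re_part_plus !re_inner_plus_r.
rewrite (inner_conj H x y) re_part_conjugate; ring.
Qed.

(** With [z = lambda y] the squared norm of [x - z] is that of [x] minus
    [2 Re <x, z>] plus that of [z], and neither correction is negative. *)
Lemma dissipative_norm_le (x y : H) (lambda : R) :
  re_part F (inner y x) <= 0 -> 0 < lambda ->
  norm x <= norm (minus x (scal (of_real F lambda) y)).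
Proof.
intros Hyx Hl.
set (z := scal (of_real F lambda) y).
assert (Hz : re_part F (inner x z) <= 0).
{ rewrite (inner_conj H z x) re_part_conjugate /z inner_scal_l re_part_mult_of_real.
  assert (Hprod := Rmult_le_compat_l lambda _ _ (Rlt_le _ _ Hl) Hyx); lra. }
assert (Hx : plus (minus x z) z = x) by apply minus_plus_cancel.
assert (Hsqr := norm_plus_sqr (minus x z) z).
assert (Hxz : re_part F (inner x z)
    = re_part F (inner (minus x z) z) + norm z ^ 2).
{ rewrite -re_inner_diag -re_part_plus -inner_plus_l Hx //. }
rewrite Hx in Hsqr.
apply sqr_le_inv; [apply norm_ge_0 |].
assert (Hzpos := pow2_ge_0 (norm z)); lra.
Qed.

(** The Riemann integral and the Banach space results above live in real
    spaces, to which operators of a complex space are passed by this lemma. *)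
Lemma linear_restrict_scalars (l : H -> H) :
  is_linear l ->
  @is_linear R_AbsRing (restrict_scalars F H) (restrict_scalars F H) l.
Proof.
intros Hl; split.
- exact (linear_plus l Hl).
- intros k x; exact (linear_scal l Hl (of_real F k) x).
- exact (linear_norm l Hl).
Qed.

(** [operator_norm] is the real part of an extended supremum; the bound
    contained in linearity makes the supremum finite, so that nothing is lost
    in taking [real]. *)
Lemma operator_norm_correct (l : H -> H) :
  is_linear l -> forall x, norm x <= 1 -> norm (l x) <= operator_norm l.
Proof.
intros Hl x Hx; unfold operator_norm.
destruct (Lub_Rbar_correct (fun c => exists x : H, norm x <= 1 /\ c = norm (l x)))
  as [Hub Hleast].
destruct (linear_norm l Hl) as [C [HC Hbound]].
assert (Hfin : Rbar_le (Lub_Rbar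
    (fun c => exists x : H, norm x <= 1 /\ c = norm (l x))) C).
{ apply Hleast; intros c [y [Hy ->]]; simpl.
  apply Rle_trans with (1 := Hbound y).
  rewrite <- (Rmult_1_r C) at 2; apply Rmult_le_compat_l; lra. }
specialize (Hub (norm (l x)) (ex_intro _ x (conj Hx eq_refl))).
destruct (Lub_Rbar _) as [r | |]; [exact Hub | easy | easy].
Qed.

Lemma operator_norm_ge_0 (l : H -> H) : is_linear l -> 0 <= operator_norm l.
Proof.
intros Hl; apply Rle_trans with (norm (l zero)); [apply norm_ge_0 |].
apply operator_norm_correct; [exact Hl |].
rewrite norm_zero; lra.
Qed.

Lemma operator_norm_bound (l : H -> H) (x : H) :
  is_linear l -> norm (l x) <= operator_norm l * norm x.
Proof.
intros Hl; destruct (Rle_lt_or_eq_dec _ _ (norm_ge_0 x)) as [Hx | Hx].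
- set (k := / norm x).
  assert (Hk : 0 < k) by now apply Rinv_0_lt_compat.
  assert (Hlk := linear_restrict_scalars l Hl).
  assert (Hunit : norm (real_scal F H k x) <= 1).
  { apply Rle_trans with (1 := real_norm_scal F H k x).
    change (Rabs k * norm x <= 1).
    rewrite -> Rabs_pos_eq by lra; unfold k; rewrite Rinv_l; lra. }
  assert (Hle := operator_norm_correct l Hl _ Hunit).
  assert (Hback : norm (l x) <= norm x * norm (l (real_scal F H k x))).
  { replace (l x) with (real_scal F H (norm x) (l (real_scal F H k x))).
    - apply Rle_trans with (1 := real_norm_scal F H _ _).
      change (Rabs (norm x) * norm (l (real_scal F H k x))
        <= norm x * norm (l (real_scal F H k x))).
      rewrite -> Rabs_pos_eq by lra; lra.
    - refine (eq_trans (eq_sym (linear_scal _ Hlk (norm x) _)) (f_equal l _)).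
      change (real_scal F H (norm x) (real_scal F H k x) = x).
      rewrite real_scal_assoc.
      replace (mult (norm x : R_Ring) k) with (@one R_Ring);
        [apply real_scal_one |].
      unfold k, mult, one; simpl; field; lra. }
  apply Rle_trans with (1 := Hback).
  rewrite Rmult_comm; apply Rmult_le_compat_r; lra.
- rewrite -Hx Rmult_0_r.
  destruct (linear_norm l Hl) as [C [_ HC]].
  apply Rle_trans with (1 := HC x); rewrite -Hx; lra.
Qed.

Lemma generated_semigroup_contraction (A : unbounded_operator H)
    (T : R -> H -> H) (K : R) :
  dissipative A -> generates A T -> 0 < K ->
  (forall s x, 0 <= s -> norm (T s x) <= K * norm x) ->
  forall s x, 0 <= s -> norm (T s x) <= norm x.
Proof.
intros HA [HT Hgen] HK Hbound s x Hs.
refine (@dissipative_semigroup_contraction (restrict_scalars F H) T K HK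
  _ (semigroup_zero _ HT) (semigroup_plus _ HT) (semigroup_cont _ HT)
  Hbound _ x s Hs).
- intros r Hr; exact (linear_restrict_scalars _ (semigroup_linear _ HT r Hr)).
- intros y z Hyz lambda Hlambda.
  destruct (proj2 (Hgen y z) Hyz) as [Hdom <-].
  exact (dissipative_norm_le y (op A y) lambda (HA y Hdom) Hlambda).
Qed.

End HilbertSpace.

(** * The growth factor of a cycle *)

Lemma nonneg_of_derive_nonneg (f df : R -> R) :
  0 <= f 0 -> (forall x, is_derive f x (df x)) ->
  (forall x, 0 <= x -> 0 <= df x) -> forall x, 0 <= x -> 0 <= f x.
Proof.
intros Hf0 Hder Hpos x Hx.
destruct (MVT_gen f 0 x df) as [c [Hc Heq]].
- intros; apply Hder.
- intros y _; apply continuity_pt_filterlim.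
  apply (ex_derive_continuous f); exists (df y); apply Hder.
- rewrite -> Rmin_left in Hc by exact Hx.
  assert (Hprod := Rmult_le_pos _ _ (Hpos c (proj1 Hc)) Hx); lra.
Qed.

Lemma exp_ge_quadratic (x : R) : 0 <= x -> 1 + x + x ^ 2 / 2 <= exp x.
Proof.
intros Hx.
enough (0 <= exp x - (1 + x + x ^ 2 / 2)) by lra.
revert x Hx; apply nonneg_of_derive_nonneg with (fun x => exp x - (1 + x)).
- rewrite exp_0; lra.
- intros x; auto_derive; [easy | field].
- intros x _; assert (Hexp := exp_ineq1_le x); lra.
Qed.

(** Both sides are compared through their derivatives in [x]. At [x = 0] the
    difference is 0, and its derivative is
    [exp x * (a ^ 2 + 1) - 2 * (a + x)]. With [exp x] replaced by its quadratic
    lower bound [P], this is a quadratic in [a] whose product with [P] is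
    [(P a - 1) ^ 2 + x ^ 4 / 4]. The linear bound [1 + x] would leave
    [- x ^ 2] in place of [x ^ 4 / 4], so the second order is needed. *)
Lemma sqr_plus_le_exp (a x : R) :
  0 <= x -> (a + x) ^ 2 <= exp x * (a ^ 2 + 1 - exp (- x)).
Proof.
intros Hx.
replace (exp x * (a ^ 2 + 1 - exp (- x))) with (exp x * (a ^ 2 + 1) - 1).
2: { rewrite Rmult_minus_distr_l -exp_plus Rplus_opp_r exp_0 //. }
enough (0 <= exp x * (a ^ 2 + 1) - 1 - (a + x) ^ 2) by lra.
revert x Hx; apply nonneg_of_derive_nonneg with
  (fun x => exp x * (a ^ 2 + 1) - 2 * (a + x)).
- rewrite exp_0; ring_simplify; lra.
- intros x; auto_derive; [easy | ring].
- intros x Hx; assert (Hexp := exp_ge_quadratic x Hx).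
  set (P := 1 + x + x ^ 2 / 2) in Hexp.
  assert (HP : 1 <= P) by (unfold P; nra).
  apply Rle_trans with (P * (a ^ 2 + 1) - 2 * (a + x)); [| nra].
  apply Rmult_le_reg_l with P; [lra |].
  rewrite Rmult_0_r.
  replace (P * (P * (a ^ 2 + 1) - 2 * (a + x)))
    with ((P * a - 1) ^ 2 + x ^ 4 / 4) by (unfold P; field).
  assert (Hsqr := pow2_ge_0 (P * a - 1)); assert (Hx4 := pow_le x 4 Hx); lra.
Qed.

(** * Iterating over the cycles *)

Lemma exp_partial_sums_small (S : nat -> R) (Y eps : R) :
  is_lim_seq S m_infty -> 0 <= Y -> 0 < eps ->
  exists N, forall n, (N <= n)%nat -> exp (S n) * Y < eps.
Proof.
intros HS HY Heps; apply is_lim_seq_spec in HS.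
(* [Y + 1] rather than [Y], as [Y] may vanish. *)
destruct (HS (ln (eps / (Y + 1)))) as [N HN]; exists N; intros n Hn.
assert (Hq : 0 < eps / (Y + 1)) by (apply Rdiv_lt_0_compat; lra).
assert (Hexp := exp_increasing _ _ (HN n Hn)).
rewrite -> exp_ln in Hexp by exact Hq.
assert (Hpos := exp_pos (S n)).
apply Rle_lt_trans with (exp (S n) * (Y + 1)); [nra |].
replace eps with (eps / (Y + 1) * (Y + 1)) by (field; lra).
apply Rmult_lt_compat_r; lra.
Qed.

Lemma product_bound (y q : nat -> R) :
  (forall n, 0 < q n) -> (forall n, y (S n) <= q n * y n) ->
  forall n, y (S n) <= exp (sum_n (fun k => ln (q k)) n) * y 0%nat.
Proof.
intros Hq Hy; induction n as [| n IH].
- rewrite sum_O exp_ln //; apply Hy.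
- rewrite sum_Sn exp_plus exp_ln //.
  apply Rle_trans with (1 := Hy (S n)).
  assert (Hprod := Rmult_le_compat_l _ _ _ (Rlt_le _ _ (Hq (S n))) IH); lra.
Qed.

(** Each cycle lasts at least [tau], so the switching times tend to infinity
    and the cycles exhaust the half-line. *)
Lemma switching_cycle_containing (t : nat -> R) (tau s : R) :
  0 < tau -> (forall n, t (2 * n)%nat + tau <= t (2 * n + 2)%nat) ->
  t 0%nat <= s ->
  exists n, t (2 * n)%nat <= s < t (2 * n + 2)%nat.
Proof.
intros Htau Hstep Hs.
assert (Hlin : forall n, t 0%nat + INR n * tau <= t (2 * n)%nat).
{ induction n as [| n IH]; [simpl; lra |].
  replace (2 * S n)%nat with (2 * n + 2)%nat by lia.
  rewrite S_INR; assert (Hn := Hstep n); lra. }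
assert (Hreach : exists N, s < t (2 * N)%nat).
{ destruct (INR_unbounded ((s - t 0%nat) / tau)) as [N HN]; exists N.
  apply Rlt_le_trans with (2 := Hlin N).
  apply (Rmult_lt_compat_r tau) in HN; [| exact Htau].
  replace ((s - t 0%nat) / tau * tau) with (s - t 0%nat) in HN by (field; lra).
  lra. }
destruct Hreach as [N HN]; revert HN.
induction N as [| N IH]; intros HN; [simpl in HN; lra |].
destruct (Rlt_le_dec s (t (2 * N)%nat)) as [Hlt | Hge]; [now apply IH |].
exists N; split; [exact Hge |].
now replace (2 * N + 2)%nat with (2 * S N)%nat by lia.
Qed.

(** * Decay of the solution *)

Theorem theorem3p6 (F : scalar_kind) (H : Hilbert F)
    (A : unbounded_operator H) (T : R -> H -> H) (M mu tau : R)
    (t : nat -> R) (Bseq : nat -> H -> H) (B : R -> H -> H)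
    (HA : dissipative A)
    (HT : generates A T)
    (HM : 0 < M) (Hmu : 0 < mu) (Htau : 0 < tau)
    (Hdecay : forall s, 0 <= s -> operator_norm (T s) <= M * exp (- mu * s))
    (Ht0 : t 0%nat = 0)
    (Htincr : forall n, t n < t (S n))
    (HBseq : forall n, is_linear (Bseq (2 * n + 1)%nat))
    (HB : intermittent_feedback t Bseq B)
    (Hodd : forall n, interval_length t (2 * n + 1) <= tau)
    (Heven : forall n, tau <= interval_length t (2 * n))
    (Hstar : forall n, / mu * ln M < interval_length t (2 * n)) :
  let c n := M ^ 2 * exp (- 2 * mu * interval_length t (2 * n)) in
  let b n := operator_norm (Bseq (2 * n + 1)%nat) in
  let d n := interval_length t (2 * n + 1) in
  is_lim_seq
    (sum_n (fun n => ln (exp (b n * d n) * (c n + 1 - exp (- (b n * d n))))))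
    m_infty ->
  forall (U0 : H) (U : R -> H),
    mild_solution T B tau U0 U ->
    is_lim (fun s => norm (U s)) p_infty 0.
Proof.
intros c b d Hsum U0 U [_ Hmild].
destruct HT as [HC0 Hgen].
assert (Hlin := fun s Hs =>
  linear_restrict_scalars _ (semigroup_linear _ HC0 s Hs)).
assert (Hexpdecay : forall s x, 0 <= s ->
    norm (T s x) <= M * exp (- mu * s) * norm x).
{ intros s x Hs.
  apply Rle_trans with
    (1 := operator_norm_bound _ x (semigroup_linear _ HC0 s Hs)).
  apply Rmult_le_compat_r; [apply norm_ge_0 | now apply Hdecay]. }
assert (Hcontr : forall s x, 0 <= s -> norm (T s x) <= norm x).
{ apply (generated_semigroup_contraction A T M HA (conj HC0 Hgen) HM).
  intros s x Hs; apply Rle_trans with (1 := Hexpdecay s x Hs).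
  apply Rmult_le_compat_r; [apply norm_ge_0 |].
  rewrite <- (Rmult_1_r M) at 2; apply Rmult_le_compat_l; [lra |].
  destruct (Rle_lt_or_eq_dec 0 s Hs) as [Hpos | <-].
  - rewrite -exp_0; apply Rlt_le, exp_increasing.
    assert (Hprod := Rmult_lt_0_compat _ _ Hmu Hpos); lra.
  - rewrite Rmult_0_r exp_0; lra. }
assert (Htpos : forall n, 0 <= t n).
{ induction n as [| n IH]; [lra | assert (Hn := Htincr n); lra]. }
assert (Hlen : forall n, t (2 * n + 1)%nat = t (2 * n)%nat
    + interval_length t (2 * n) /\
    t (2 * n + 2)%nat = t (2 * n + 1)%nat + d n /\ 0 < d n).
{ intros n; unfold d, interval_length.
  replace (2 * n + 2)%nat with (S (2 * n + 1)) by lia.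
  replace (S (2 * n))%nat with (2 * n + 1)%nat by lia.
  assert (Hn := Htincr (2 * n + 1)%nat); lra. }
set (q := fun n => exp (b n * d n) * (c n + 1 - exp (- (b n * d n)))).
change (is_lim_seq (sum_n (fun n => ln (q n))) m_infty) in Hsum.
set (a := fun n => M * exp (- mu * interval_length t (2 * n))).
assert (Hb : forall n, 0 <= b n)
  by (intros n; apply operator_norm_ge_0, HBseq).
assert (Hbd : forall n, 0 <= b n * d n).
{ intros n; apply Rmult_le_pos; [apply Hb |].
  destruct (Hlen n) as [_ [_ Hd]]; lra. }
assert (Hq : forall n, (a n + b n * d n) ^ 2 <= q n).
{ intros n; unfold q; replace (c n) with (a n ^ 2).
  - now apply sqr_plus_le_exp.
  - unfold a, c; rewrite Rpow_mult_distr; f_equal.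
    rewrite /= Rmult_1_r -exp_plus; f_equal; ring. }
assert (Ha : forall n, 0 < a n)
  by (intros n; apply Rmult_lt_0_compat; [exact HM | apply exp_pos]).
assert (Hqpos : forall n, 0 < q n).
{ intros n; apply Rlt_le_trans with (2 := Hq n), pow_lt.
  assert (Han := Ha n); assert (Hbdn := Hbd n); lra. }
assert (Hcycle : forall n,
    (forall s, t (2 * n)%nat <= s <= t (2 * n + 1)%nat ->
       norm (U s) <= norm (U (t (2 * n)%nat))) /\
    (forall s, t (2 * n + 1)%nat <= s <= t (2 * n + 2)%nat ->
       norm (U s) ^ 2 <= q n * norm (U (t (2 * n)%nat)) ^ 2)).
{ intros n; destruct (Hlen n) as [Hl1 [Hl2 Hd]].
  assert (Hev := Heven n); assert (Hod := Hodd n).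
  change (d n <= tau) in Hod.
  destruct (@delay_cycle (restrict_scalars F H) T
    (fun s => B s (U (s - tau))) U U0 Hlin (semigroup_plus _ HC0) Hcontr Hmild
    M mu tau (b n) (t (2 * n)%nat) (t (2 * n + 1)%nat) (t (2 * n + 2)%nat)
    Hexpdecay (Htpos _) ltac:(lra) ltac:(lra) ltac:(lra) (Hb n))
    as [Hoff Hon].
  - intros s Hs; apply (proj1 (HB n) s Hs).
  - intros s Hs.
    destruct (Rle_lt_or_eq_dec _ _ (proj2 Hs)) as [Hlt | ->].
    + rewrite (proj2 (HB n) s (conj (proj1 Hs) Hlt)).
      exact (operator_norm_bound _ _ (HBseq n)).
    + (* At the right end point the feedback is already off. *)
      assert (Hzero : forall x, B (t (2 * n + 2)%nat) x = zero).
      { apply (proj1 (HB (S n))).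
        replace (2 * S n)%nat with (2 * n + 2)%nat by lia.
        replace (2 * n + 2 + 1)%nat with (S (2 * n + 2)) by lia.
        assert (Hnext := Htincr (2 * n + 2)%nat); lra. }
      rewrite Hzero; apply Rle_trans with 0; [apply Req_le, @norm_zero |].
      apply Rmult_le_pos; [apply Hb | apply norm_ge_0].
  - split; [exact Hoff |]; intros s Hs; specialize (Hon s Hs).
    replace (t (2 * n + 1)%nat - t (2 * n)%nat) with
      (interval_length t (2 * n)) in Hon by lra.
    replace (t (2 * n + 2)%nat - t (2 * n + 1)%nat) with (d n) in Hon by lra.
    change (norm (U s) <= (a n + b n * d n) * norm (U (t (2 * n)%nat))) in Hon.
    apply Rle_trans with (((a n + b n * d n) * norm (U (t (2 * n)%nat))) ^ 2).
    + apply pow_incr; split; [apply norm_ge_0 | exact Hon].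
    + rewrite Rpow_mult_distr; apply Rmult_le_compat_r; [apply pow2_ge_0 |].
      apply Hq. }
set (y := fun n => norm (U (t (2 * n)%nat)) ^ 2).
assert (Hy : forall n, y (S n) <= exp (sum_n (fun k => ln (q k)) n) * y 0%nat).
{ apply product_bound; [exact Hqpos |]; intros n; unfold y.
  replace (2 * S n)%nat with (2 * n + 2)%nat by lia.
  apply (Hcycle n); destruct (Hlen n) as [_ [Hl2 Hd]]; lra. }
apply is_lim_spec; intros eps; simpl.
destruct (exp_partial_sums_small _ (y 0%nat) (eps ^ 2) Hsum
  (pow2_ge_0 _) (pow_lt _ _ (cond_pos eps))) as [N HN].
(* Beyond this time the current cycle has index [S m] with [N <= m]. The
   partial sum up to [m] controls its delay-free half, the partial sum up to
   [S m] the rest. *)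
exists (t (2 * (N + 1))%nat); intros s Hs.
destruct (switching_cycle_containing t tau s Htau) as [n Hn].
{ intros n; destruct (Hlen n) as [Hl1 [Hl2 Hd]]; assert (Hev := Heven n); lra. }
{ rewrite Ht0; assert (Hpos := Htpos (2 * (N + 1))%nat); lra. }
assert (HNn : (N + 1 <= n)%nat).
{ destruct (Nat.le_gt_cases (N + 1) n) as [| Hlt]; [assumption | exfalso].
  assert (Hmono : forall i j, (i <= j)%nat -> t i <= t j).
  { intros i j Hij; induction Hij as [| j Hij IH]; [lra |].
    assert (Hj := Htincr j); lra. }
  assert (Hlate := Hmono (2 * n + 2)%nat (2 * (N + 1))%nat ltac:(lia)); lra. }
destruct n as [| m]; [lia |].
assert (Hm := Hy m); assert (Hsm := HN m ltac:(lia)).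
assert (HSm := HN (S m) ltac:(lia)).
rewrite -> Rminus_0_r, Rabs_pos_eq by apply norm_ge_0.
assert (Heps := cond_pos eps).
apply Rnot_le_lt; intros Hle.
assert (Hle2 : eps ^ 2 <= norm (U s) ^ 2) by (apply pow_incr; lra).
destruct (Rle_lt_dec s (t (2 * S m + 1)%nat)) as [Hs1 | Hs1].
- assert (Hoff := proj1 (Hcycle (S m)) s ltac:(lra)).
  assert (Hoff2 : norm (U s) ^ 2 <= y (S m)).
  { apply pow_incr; split; [apply norm_ge_0 | exact Hoff]. }
  lra.
- assert (Hon := proj2 (Hcycle (S m)) s ltac:(lra)).
  change (norm (U s) ^ 2 <= q (S m) * y (S m)) in Hon.
  assert (Hstep := Rmult_le_compat_l _ _ _ (Rlt_le _ _ (Hqpos (S m))) Hm).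
  rewrite sum_Sn exp_plus (exp_ln _ (Hqpos (S m))) in HSm.
  lra.
Qed.
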